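(* Let $S$ be a linear operator acting on a Hilbert space $\mathcal{H}$. The following statements are equivalent: (i) $S$ is essentially selfadjoint; (ii) (a) $S$ is densely defined; (b) $S\wedge S$; (c) $-\lambda^2\notin\sigma_p(S^{*2})$ for a certain (and also for all) $\lambda\in\mathbb{R}$, $\lambda\neq0$.
   Context: Hilbert spaces are real or complex. A linear operator $S$ on $\mathcal{H}$ is a linear map $S:\operatorname{dom}S\to\mathcal{H}$ defined on a linear subspace $\operatorname{dom}S\subseteq\mathcal{H}$; it is not assumed bounded, closed or densely defined unless stated. $S$ is closable if the closure of its graph is the graph of an operator, denoted $\bar S$. The adjoint $S^*$ of a densely defined $S$ has domain $\{k:\exists h'\ \forall h\in\operatorname{dom}S,\ \langle Sh,k\rangle=\langle h,h'\rangle\}$ and $S^*k:=h'$. $S^{*2}=S^*S^*$ has domain $\{h\in\operatorname{dom}S^*:S^*h\in\operatorname{dom}S^*\}$. An operator is selfadjoint if it is densely defined and equals its adjoint (with equal domains). $S$ is essentially selfadjoint if it is densely defined, closable, and $\bar S$ is selfadjoint. $S\wedge S$ means $\langle Sh,k\rangle=\langle h,Sk\rangle$ for all $h,k\in\operatorname{dom}S$. $\sigma_p(A)$ is the point spectrum: $\mu\in\sigma_p(A)$ iff there is a nonzero $h\in\operatorname{dom}A$ with $Ah=\mu h$. ''For a certain (and also for all) $\lambda$'' means: statement (ii) with ''for some $\lambda$'' and statement (ii) with ''for all $\lambda$'' are both equivalent to (i). *)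

(* Defs.v *)
(* MathComp-Analysis, with R[i] from mathcomp-real-closed for the complex
   numbers. *)
From HB Require Import structures.
From mathcomp Require Import all_boot all_order all_algebra.
From mathcomp Require Import complex.
From mathcomp Require Import boolp classical_sets reals topology normedtype.

Set Implicit Arguments.
Unset Strict Implicit.
Unset Printing Implicit Defensive.

Import Order.TTheory GRing.Theory Num.Theory.
Import numFieldNormedType.Exports.

Local Open Scope classical_set_scope.
Local Open Scope ring_scope.

Inductive scalar_kind := RealScalars | ComplexScalars.

Definition scalar_field (R : realType) (s : scalar_kind) : numFieldType :=
  match s with
  | RealScalars => R
  | ComplexScalars => R[i]
  end.

Definition scalar_conj (R : realType) (s : scalar_kind) :
    {rmorphism scalar_field R s -> scalar_field R s} :=
  match s with
  | RealScalars => idfun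
  | ComplexScalars => @conjc R
  end.

(* An inner product is linear in its first argument.  The norm of H, hence its
   (complete) topology, is required to be the one given by the inner product. *)
Record hilbertType (R : realType) (s : scalar_kind) := Hilbert {
  hilbert_space :> completeNormedModType (scalar_field R s);
  inner : {dot hilbert_space for scalar_conj R s};
  inner_norm : forall h, inner h h = `|h| ^+ 2
}.

Arguments inner {R s} H : rename.

(* The values of a partial map outside its domain are irrelevant. *)
Record operator (H : Type) := Operator {
  dom : set H;
  app :> H -> H
}.

Definition op_graph (H : Type) (S : operator H) : set (H * H) :=
  [set p | dom S p.1 /\ p.2 = S p.1].

Definition op_comp (H : Type) (A B : operator H) : operator H :=
  Operator [set h | dom B h /\ dom A (B h)] (fun h => A (B h)).

Section Operators.
Variables (R : realType) (s : scalar_kind) (H : hilbertType R s).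
Implicit Types S T A : operator H.

Definition linear_operator S : Prop :=
  [/\ dom S 0,
      forall (a : scalar_field R s) (h k : H),
        dom S h -> dom S k -> dom S (a *: h + k)
    & forall (a : scalar_field R s) (h k : H),
        dom S h -> dom S k -> S (a *: h + k) = a *: S h + S k].

Definition densely_defined S : Prop := dense (dom S).

Definition closable S : Prop :=
  exists T, linear_operator T /\ op_graph T = closure (op_graph S).

(* Meaningful only for closable S: the graph of closure_op S is then
   closure (op_graph S). *)
Definition closure_op S : operator H :=
  Operator [set h | exists k : H, closure (op_graph S) (h, k)]
           (fun h => get [set k : H | closure (op_graph S) (h, k)]).

Definition adjoint_image S (k : H) : set H :=
  [set h' | forall h : H, dom S h -> inner H (S h) k = inner H h h'].

(* Meaningful only for densely defined S: adjoint_image S k then has at most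
   one element. *)
Definition adjoint S : operator H :=
  Operator [set k | exists h', adjoint_image S k h']
           (fun k => get (adjoint_image S k)).

Definition selfadjoint S : Prop :=
  [/\ densely_defined S,
      dom (adjoint S) = dom S
    & forall h, dom S h -> adjoint S h = S h].

Definition essentially_selfadjoint S : Prop :=
  [/\ densely_defined S, closable S & selfadjoint (closure_op S)].

Definition op_wedge S T : Prop :=
  forall h k : H, dom S h -> dom T k -> inner H (S h) k = inner H h (T k).

Definition point_spectrum A : set (scalar_field R s) :=
  [set mu | exists h : H, [/\ h != 0, dom A h & A h = mu *: h]].

End Operators.

(* Main.v *)
Require Import Defs.
From HB Require Import structures.
From mathcomp Require Import all_boot all_order all_algebra.
From mathcomp Require Import complex.
From mathcomp Require Import boolp classical_sets reals interval_inference.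
From mathcomp Require Import topology normedtype.
From mathcomp Require Import ring.

(** Everything takes place in H * H, where the two graphs to compare live.  For
    a densely defined S the graph of the adjoint S^* is closed, and it depends
    only on the closure of the graph of S.  Hence S is essentially selfadjoint
    if and only if the graph of S^* is the closure of the graph of S
    ([essentially_selfadjointP]), while the symmetry of S says that the graph
    of S is contained in that of S^* ([op_wedge_adjoint]).

    If S is essentially selfadjoint and S^* S^* h = - lambda^2 h, then, since
    the adjoint of S^* is S^* again,
      - lambda^2 <h, h> = <S^* S^* h, h> = <S^* h, S^* h> >= 0,
    which forces h = 0 ([essentially_selfadjoint_point_spectrum]).

    Conversely, let S be symmetric with - lambda^2 not in the point spectrum of
    S^* S^*.  On H * H put the inner product
      lambda^2 <p.1, q.1> + <p.2, q.2>,
    which induces the topology of H * H.  Let (h, k) be the difference between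
    a point of the graph of S^* and its orthogonal projection on the closure of
    the graph of S.  It lies in the graph of S^*, so k = S^* h; being
    orthogonal to every (x, S x) it satisfies
      <S x, k> = - lambda^2 <x, h>  for all x in dom S,
    that is, S^* k = - lambda^2 h.  So h is 0 by hypothesis, then k is 0, and
    the closure of the graph of S fills the graph of S^*
    ([adjoint_sub_closure]).

    This argument never uses imaginary numbers, and so it treats real and
    complex scalars alike; the two cases are separated only for the elementary
    properties of the conjugation and for the existence of infima.  The one
    result of Hilbert space theory behind it is the projection theorem
    ([weighted_projection]), proved by means of a minimizing filter: the
    tolerances are positive scalars, and filtering by the sets of almost
    minimizing vectors avoids the choice of a sequence of them tending to 0. *)

Set Implicit Arguments.
Unset Strict Implicit.
Unset Printing Implicit Defensive.

Import Order.TTheory GRing.Theory Num.Theory.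
Import numFieldNormedType.Exports.
Local Open Scope classical_set_scope.
Local Open Scope ring_scope.

(** * Real and complex scalars *)

Section Scalars.
Context {R : realType} {s : scalar_kind}.
Local Notation K := (scalar_field R s).
Local Notation conj := (@scalar_conj R s).

Lemma scalar_conjM (a : K) : a * conj a = `|a| ^+ 2.
Proof.
case: s a => a /=; first by rewrite -normrX ger0_norm ?sqr_ge0// expr2.
by rewrite sqr_normc.
Qed.

Lemma scalar_conj_real (a : K) : a \is Num.real -> conj a = a.
Proof.
case: s a => [//|a] /complex_realP[x ->] /=.
exact: conjc_real.
Qed.

Lemma scalar_conj_norm (a : K) : `|conj a| = `|a|.
Proof.
case: s a => //= -[x y] /=.
by rewrite normc_def/= sqrrN.
Qed.

(** Nonnegative scalars are real in both cases, so the completeness of the real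
    numbers provides infima although complex scalars are only partially
    ordered. *)
Lemma scalar_inf (A : set K) : A !=set0 -> (forall a, A a -> 0 <= a) ->
  exists d : K, (forall a, A a -> d <= a) /\
    (forall e, 0 < e -> exists2 a, A a & a < d + e).
Proof.
case: s A => A [a0 Aa0] A_ge0.
  have infA : has_inf A by split; [exists a0|exists 0].
  exists (inf A); split.
  - by move=> a Aa; apply: ge_inf => //; exact: infA.2.
  - by move=> e e0; exact: inf_adherent.
have Areal (a : R[i]) : A a -> a = (complex.Re a)%:C%C.
  by case: a => x y /A_ge0; rewrite lecE/= => /andP[/eqP-> _].
pose B := @complex.Re R @` (A : set R[i]).
have B0 : B !=set0 by exists (complex.Re a0), a0.
have Blb : lbound B 0.
  by move=> _ [a Aa <-]; move: (A_ge0 _ Aa); rewrite (Areal a)// lecR.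
have infB : has_inf B by split => //; exists 0.
exists (inf B)%:C%C; split.
- move=> a Aa; rewrite (Areal _ Aa) lecR; apply: ge_inf; first exact: infB.2.
  by exists a.
- move=> [e1 e2]; rewrite ltcE/= => /andP[/eqP-> e1_gt0].
  have [_ [a Aa <-] lt_a] := inf_adherent e1_gt0 infB.
  exists a => //.
  by rewrite (Areal _ Aa) -[(_ +i* _)%C]/(e1%:C)%C -rmorphD ltcR.
Qed.

End Scalars.

(** * Inner products *)

(** The expansion of g (u - t v) (u - t v) for an inner product g and
    t = g u v / g v v, with p, m, a, b in the place of g u u, g v v, g u v and
    its conjugate g v u. *)
Lemma projection_residue_identity (F : fieldType) (p m a b : F) : m != 0 ->
  p + b / m * (a / m * m) - (b / m * a + a / m * b) = p - a * b / m.
Proof. by move=> m0; field. Qed.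

Section DotProducts.
Context {R : realType} {s : scalar_kind}.
Local Notation K := (scalar_field R s).
Local Notation conj := (@scalar_conj R s).
Context {U : lmodType K} (g : {dot U for conj}).

Lemma dot_conj u v : g u v = conj (g v u).
Proof. by rewrite hermC expr0 mul1r. Qed.

Lemma dot_ge0 u : 0 <= g u u.
Proof.
have [->|u0] := eqVneq u 0; first by rewrite linear0l.
exact/ltW/neq0_dnorm_gt0.
Qed.

(** If subtracting a multiple of v never lowers g u u by more than e, then u is
    nearly orthogonal to v: the best multiple lowers it by |g u v|^2 / g v v.
    For e = 0 this is the orthogonality of a minimizer, and for e = g u u, where
    the hypothesis holds automatically, the Cauchy-Schwarz inequality. *)
Lemma dot_near_min (u v : U) (e : K) :
  (forall t : K, g u u <= g (u - t *: v) (u - t *: v) + e) ->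
  `|g u v| ^+ 2 <= e * g v v.
Proof.
have [-> /(_ 0)|v0 min_u] := eqVneq v 0.
  by rewrite !linear0r normr0 expr0n/= mulr0.
have gv_gt0 : 0 < g v v by exact: neq0_dnorm_gt0.
have gv_real : conj (g v v) = g v v by rewrite -dot_conj.
(* This multiple of v is the orthogonal projection of u on the line of v. *)
have := min_u (g u v / g v v).
have -> : g (u - (g u v / g v v) *: v) (u - (g u v / g v v) *: v) =
    g u u - `|g u v| ^+ 2 / g v v.
  rewrite hnormB expr0 mul1r !linearZr_LR/= !linearZl_LR/=.
  rewrite !rmorphM/= -!dot_conj !fmorphV/= !gv_real -scalar_conjM -dot_conj.
  exact/projection_residue_identity/lt0r_neq0.
rewrite -addrA -[leLHS]addr0 lerD2l addrC subr_ge0.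
by rewrite ler_pdivrMr.
Qed.

Lemma dot_cauchy_schwarz u v : `|g u v| ^+ 2 <= g u u * g v v.
Proof. by apply: dot_near_min => t; rewrite lerDr dot_ge0. Qed.

Lemma dot_parallelogram u v :
  g (u - v) (u - v) + g (u + v) (u + v) = (g u u + g v v) *+ 2.
Proof. by rewrite hnormB hnormD expr0 mul1r mulr2n addrACA addNr addr0. Qed.

End DotProducts.

Section InnerContinuity.
Context {R : realType} {s : scalar_kind} (H : hilbertType R s).
Local Notation K := (scalar_field R s).

Lemma inner_le_norm (h k : H) : `|inner H h k| <= `|h| * `|k|.
Proof.
rewrite -(@ler_pXn2r _ 2) ?nnegrE ?mulr_ge0// exprMn -!inner_norm.
exact: dot_cauchy_schwarz.
Qed.

Lemma inner_continuousl (k : H) : continuous (fun h => inner H h k : K^o).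
Proof.
move=> h; apply/cvgrPdist_le => /= e e0.
have k1 : 0 < `|k| + 1 by rewrite ltr_wpDl.
near=> x; rewrite -linearBl; apply: le_trans (inner_le_norm _ _) _.
(* |k| + 1 replaces |k|, which may vanish, as a divisor. *)
apply: (@le_trans _ _ (`|h - x| * (`|k| + 1))).
  by rewrite ler_wpM2l// lerDl.
rewrite -ler_pdivlMr//.
near: x; apply: cvgr_dist_le => //; exact: divr_gt0.
Unshelve. all: by end_near. Qed.

Lemma inner_continuousr (h : H) : continuous (fun k => inner H h k : K^o).
Proof.
move=> k; apply/cvgrPdist_le => /= e e0.
have /cvgrPdist_le/(_ _ e0) := @inner_continuousl h k.
apply: filterS => x; rewrite -linearBl -linearBr.
by rewrite /= [inner H h (_ - _)]dot_conj scalar_conj_norm.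
Qed.

End InnerContinuity.

(** * The weighted inner product on H * H *)

Section WeightedDot.
Context {R : realType} {s : scalar_kind} (H : hilbertType R s).
Local Notation K := (scalar_field R s).
Local Notation conj := (@scalar_conj R s).

(** The norm of H * H is a maximum, which in general does not come from an inner
    product; for every positive weight this form defines an equivalent norm. *)
Definition weighted_dot (c : {posnum K}) (p q : H * H) : K :=
  c%:num * inner H p.1 q.1 + inner H p.2 q.2.

Variable c : {posnum K}.

Let conj_weight : conj c%:num = c%:num.
Proof. by rewrite scalar_conj_real. Qed.

Let weighted_dot_bilinear :
  bilinear_for *%R (conj \; *%R) (weighted_dot c).
Proof.
split=> p a q r; rewrite /weighted_dot/= !(linearPl, linearPr)/=; ring.
Qed.

HB.instance Definition _ := @bilinear_isBilinear.Build K (H * H)%type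
  (H * H)%type K *%R (conj \; *%R) (weighted_dot c) weighted_dot_bilinear.

Let weighted_dot_hermitian p q :
  weighted_dot c p q = (-1) ^+ false * conj (weighted_dot c q p).
Proof.
rewrite expr0 mul1r /weighted_dot rmorphD rmorphM conj_weight -!dot_conj.
by [].
Qed.

HB.instance Definition _ := isHermitianSesquilinear.Build K (H * H)%type
  false conj (weighted_dot c) weighted_dot_hermitian.

Let weighted_dot_gt0 p : p != 0 -> 0 < weighted_dot c p p.
Proof.
case: p => h k; rewrite /weighted_dot/= -pair_eqE/= negb_and.
case/orP=> h0.
  by rewrite ltr_wpDr ?dot_ge0// mulr_gt0// neq0_dnorm_gt0.
by rewrite ltr_wpDl ?neq0_dnorm_gt0// mulr_ge0// dot_ge0.
Qed.

HB.instance Definition _ := isDotProduct.Build K (H * H)%type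
  (weighted_dot c) weighted_dot_gt0.

Lemma weighted_dotE p :
  weighted_dot c p p = c%:num * `|p.1| ^+ 2 + `|p.2| ^+ 2.
Proof. by rewrite /weighted_dot !inner_norm. Qed.

Lemma weighted_dot_continuousl (q : H * H) :
  continuous (fun p => weighted_dot c p q : K^o).
Proof.
move=> p; rewrite /weighted_dot; apply: cvgD.
  apply: cvgMr; apply: (@cvg_comp _ _ _ fst (fun h => inner H h q.1 : K^o));
  [exact: cvg_fst | exact: inner_continuousl].
apply: (@cvg_comp _ _ _ snd (fun h => inner H h q.2 : K^o));
  [exact: cvg_snd | exact: inner_continuousl].
Qed.

End WeightedDot.

(** * The projection theorem *)

Section Projection.
Context {R : realType} {s : scalar_kind} (H : hilbertType R s).
Local Notation K := (scalar_field R s).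
Variables (c : {posnum K}) (V : set (H * H)).
Hypothesis V0 : V 0.
Hypothesis Vlin : forall (a : K) p q, V p -> V q -> V (a *: p + q).
Local Notation g := (@weighted_dot R s H c).

Let VZ (a : K) p : V p -> V (a *: p).
Proof. by move=> Vp; rewrite -[_ *: _]addr0; exact: Vlin. Qed.

Section MinimizingFilter.
Variables (p : H * H) (d : K).
Hypothesis d_le : forall v, V v -> d <= g (p - v) (p - v).
Hypothesis d_adh : forall e, 0 < e ->
  exists2 v, V v & g (p - v) (p - v) < d + e.

Definition near_minimizers (e : K) : set (H * H) :=
  [set v | V v /\ g (p - v) (p - v) < d + e].

Definition minimizing_filter : set_system (H * H) :=
  filter_from [set e : K | 0 < e] near_minimizers.

#[local] Instance minimizing_filter_proper : ProperFilter minimizing_filter.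
Proof.
apply: filter_from_proper; last first.
  by move=> e /d_adh[v Vv ve]; exists v.
apply: filter_from_filter; first by exists 1 => /=.
move=> e f /= e0 f0; have ef := real_comparable (gtr0_real e0) (gtr0_real f0).
exists (Order.min e f) => /=; first by case: (comparable_ltP ef).
move=> v [Vv vef]; split; split=> //; apply: (lt_le_trans vef); rewrite lerD2l.
  by rewrite comparable_ge_min// lexx.
by rewrite comparable_ge_min// lexx orbT.
Qed.

(** Parallelogram law for p - v and p - w, whose half sum is p minus the
    midpoint of v and w: the midpoint lies in V, so its squared distance to p
    is at least d, which leaves 2 (d + e) + 2 (d + e) - 4 d for v - w. *)
Lemma near_minimizers_close e v w : near_minimizers e v ->
  near_minimizers e w -> g (v - w) (v - w) < e *+ 4.
Proof.
move=> [Vv ve] [Vw we].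
have /d_le dm : V (2^-1 *: (v + w)).
  by apply: VZ; rewrite -[v]scale1r; exact: Vlin.
have pvw : (p - v) + (p - w) = 2 *: (p - 2^-1 *: (v + w)).
  rewrite scalerBr scalerA divff// scale1r scaler_nat mulr2n.
  by rewrite opprD addrACA.
have vw : (p - v) - (p - w) = - (v - w).
  by rewrite opprB opprB addrC addrA subrK.
have := dot_parallelogram g (p - v) (p - w).
rewrite vw pvw hnormN linearZr_LR/= linearZl_LR/= rmorph_nat => Epar.
have -> : g (v - w) (v - w) = (g (p - v) (p - v) + g (p - w) (p - w)) *+ 2 -
    g (p - 2^-1 *: (v + w)) (p - 2^-1 *: (v + w)) *+ 4.
  by rewrite -Epar !mulr_natl -mulrnA addrK.
apply: (@lt_le_trans _ _ ((d + e + (d + e)) *+ 2 - d *+ 4)).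
  rewrite ltr_leD//; first by rewrite ltrMn2r//= ltrD.
  by rewrite lerN2 lerMn2r.
by rewrite -mulr2n -mulrnA mulrnDl addrAC subrr add0r.
Qed.

(* Each term of the weighted sum of squares is at most the sum; the tolerances
   below are the ones that turn this into a bound by e on each component. *)
Let norm_close1 (e : K) v w : near_minimizers (c%:num * e ^+ 2 / 4) v ->
  near_minimizers (c%:num * e ^+ 2 / 4) w -> 0 < e -> `|v.1 - w.1| < e.
Proof.
move=> hv hw e0; have := near_minimizers_close hv hw.
rewrite -[X in _ < X]mulr_natr divfK// weighted_dotE => lt_e.
rewrite -(@ltr_pXn2r _ 2) ?nnegrE ?(ltW e0)// -(@ltr_pM2l _ c%:num)//.
by apply: le_lt_trans lt_e; rewrite lerDl exprn_ge0.
Qed.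

Let norm_close2 (e : K) v w : near_minimizers (e ^+ 2 / 4) v ->
  near_minimizers (e ^+ 2 / 4) w -> 0 < e -> `|v.2 - w.2| < e.
Proof.
move=> hv hw e0; have := near_minimizers_close hv hw.
rewrite -[X in _ < X]mulr_natr divfK// weighted_dotE => lt_e.
rewrite -(@ltr_pXn2r _ 2) ?nnegrE ?(ltW e0)//.
by apply: le_lt_trans lt_e; rewrite lerDr mulr_ge0// exprn_ge0.
Qed.

Let cauchy_fst : cauchy (fst @ minimizing_filter).
Proof.
apply: cauchy_exP => e e0.
have de0 : 0 < c%:num * e ^+ 2 / 4 by rewrite divr_gt0 ?mulr_gt0 ?exprn_gt0.
have [v Vv ve] := d_adh de0; exists v.1; exists (c%:num * e ^+ 2 / 4) => //.
by move=> w hw; rewrite /= -ball_normE/=; exact: norm_close1 hw e0.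
Qed.

Let cauchy_snd : cauchy (snd @ minimizing_filter).
Proof.
apply: cauchy_exP => e e0.
have de0 : 0 < e ^+ 2 / 4 by rewrite divr_gt0 ?exprn_gt0.
have [v Vv ve] := d_adh de0; exists v.2; exists (e ^+ 2 / 4) => //.
by move=> w hw; rewrite /= -ball_normE/=; exact: norm_close2 hw e0.
Qed.

Lemma minimizing_filter_cvg : exists z : H * H, minimizing_filter --> z.
Proof.
have /cauchy_cvgP/cvg_ex[z1 cvg1] := cauchy_fst.
have /cauchy_cvgP/cvg_ex[z2 cvg2] := cauchy_snd.
exists (z1, z2); apply: cvg_trans (cvg_pair cvg1 cvg2) => B.
by case=> e e0 sB; exists e => // -[a b] /sB.
Qed.

(** A competitor u + t v stays in V, so replacing u by it cannot lower the
    squared distance to p below d, that is, by more than e. *)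
Lemma near_minimizers_ortho e u v : near_minimizers e u -> V v ->
  `|g (p - u) v| ^+ 2 <= e * g v v.
Proof.
move=> [Vu ue] Vv; apply: dot_near_min => t; apply: (le_trans (ltW ue)).
rewrite lerD2r -addrA -opprD; apply: d_le.
by rewrite addrC; exact: Vlin.
Qed.

Lemma minimizing_filter_lim_closure (z : H * H) :
  minimizing_filter --> z -> closure V z.
Proof.
move=> cvgz B /cvgz[e e0 sB]; have [v Vv ve] := d_adh e0.
by exists v; split=> //; exact: sB.
Qed.

Lemma minimizing_filter_lim_ortho (z v : H * H) :
  minimizing_filter --> z -> V v -> g (p - z) v = 0.
Proof.
move=> cvgz Vv; rewrite linearBl/=.
have cvg_z : (g u v : K^o) @[u --> minimizing_filter] --> (g z v : K^o).
  apply: (@cvg_comp _ _ _ id (fun u => g u v : K^o) _ _ _ cvgz).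
  exact: weighted_dot_continuousl.
have cvg_p : (g u v : K^o) @[u --> minimizing_filter] --> (g p v : K^o).
  apply/cvgrPdist_lt => e e0 /=.
  (* The added 1 covers the case v = 0. *)
  have gv1 : 0 < g v v + 1 by rewrite ltr_wpDl// dot_ge0.
  exists (e ^+ 2 / (g v v + 1)); first by rewrite /= divr_gt0// exprn_gt0.
  move=> u /near_minimizers_ortho/(_ Vv) le_e; rewrite /= -linearBl/=.
  rewrite -(@ltr_pXn2r _ 2) ?nnegrE ?(ltW e0)//; apply: (le_lt_trans le_e).
  by rewrite mulrAC ltr_pdivrMr// ltr_pM2l ?exprn_gt0// ltrDl.
by rewrite (norm_cvg_unique cvg_p cvg_z) subrr.
Qed.

End MinimizingFilter.

(** Stated for any subspace V, with z in its closure: only graphs of operators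
    that need not be closed are projected upon. *)
Lemma weighted_projection p :
  exists2 z, closure V z & forall v, V v -> g (p - z) v = 0.
Proof.
have [||d [d_le d_adh]] :=
    @scalar_inf _ _ [set g (p - v) (p - v) | v in V].
- by exists (g (p - 0) (p - 0)), 0.
- by move=> _ [v _ <-]; exact: dot_ge0.
have {}d_le v : V v -> d <= g (p - v) (p - v).
  by move=> Vv; apply: d_le; exists v.
have {}d_adh e : 0 < e -> exists2 v, V v & g (p - v) (p - v) < d + e.
  by move=> /d_adh[_ [v Vv <-] ve]; exists v.
have [z cvgz] := minimizing_filter_cvg d_le d_adh.
exists z; first exact: (minimizing_filter_lim_closure d_adh cvgz).
by move=> v; exact: (minimizing_filter_lim_ortho d_le d_adh cvgz).
Qed.

End Projection.

(** * Adjoints and closures *)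

Lemma closure_continuous_eq0 (K : numFieldType) (T : topologicalType)
    (f : T -> K^o) (A : set T) : continuous f ->
  (forall x, A x -> f x = 0) -> forall x, closure A x -> f x = 0.
Proof.
move=> cf f0; have cl : closed [set x | f x = 0].
  apply: (@closed_comp _ _ f [set 0]) => //.
  exact/accessible_closed_set1/hausdorff_accessible/norm_hausdorff.
by move=> x /(closureS f0); move/closure_id : cl => <-.
Qed.

Lemma dense_closure (T : topologicalType) (A : set T) :
  dense A -> forall x, closure A x.
Proof.
move=> dA x B; rewrite nbhsE => -[O [oO Ox] OB].
have [y [Oy Ay]] := dA O (ex_intro _ x Ox) oO.
by exists y; split=> //; exact: OB.
Qed.

Section Adjoint.
Context {R : realType} {s : scalar_kind} {H : hilbertType R s}.
Local Notation K := (scalar_field R s).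
Implicit Types S T : operator H.

Lemma dense_ortho_eq0 (A : set H) (k : H) :
  dense A -> (forall h, A h -> inner H h k = 0) -> k = 0.
Proof.
move=> dA Ak; have [//|k0] := eqVneq k 0.
have := closure_continuous_eq0 (@inner_continuousl R s H k) Ak
  (@dense_closure _ _ dA k).
by have := @neq0_dnorm_gt0 _ _ _ (inner H) k k0; rewrite lt0r => /andP[/eqP].
Qed.

Lemma adjoint_image_unique S k h1 h2 : densely_defined S ->
  adjoint_image S k h1 -> adjoint_image S k h2 -> h1 = h2.
Proof.
move=> dS S1 S2; apply/eqP; rewrite -subr_eq0; apply/eqP.
apply: (dense_ortho_eq0 dS) => h Sh.
by rewrite linearBr/= -S1// -S2// subrr.
Qed.

Lemma adjoint_image_adjoint S k :
  dom (adjoint S) k -> adjoint_image S k (adjoint S k).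
Proof. by case=> h'; exact: getI. Qed.

Lemma op_graph_adjoint S : densely_defined S ->
  op_graph (adjoint S) = [set p | adjoint_image S p.1 p.2].
Proof.
move=> dS; apply/seteqP; split=> -[k h'] /=.
  by move=> [dk /= ->]; exact: adjoint_image_adjoint.
move=> Skh'; have dk : dom (adjoint S) k by exists h'.
split=> //=; apply: adjoint_image_unique dS Skh' _.
exact: adjoint_image_adjoint.
Qed.

Lemma adjointE S k h' : densely_defined S -> adjoint_image S k h' ->
  dom (adjoint S) k /\ adjoint S k = h'.
Proof.
move=> dS Skh'; have : op_graph (adjoint S) (k, h').
  by rewrite op_graph_adjoint.
by case=> /= ? ->.
Qed.

Lemma adjoint_image_lin S (a : K) k1 h1 k2 h2 :
  adjoint_image S k1 h1 -> adjoint_image S k2 h2 ->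
  adjoint_image S (a *: k1 + k2) (a *: h1 + h2).
Proof. by move=> S1 S2 h Sh; rewrite !linearPr/= S1// S2. Qed.

Lemma linear_operator_adjoint S :
  densely_defined S -> linear_operator (adjoint S).
Proof.
move=> dS; have lin (a : K) h k : dom (adjoint S) h -> dom (adjoint S) k ->
    dom (adjoint S) (a *: h + k) /\
    adjoint S (a *: h + k) = a *: adjoint S h + adjoint S k.
  by move=> /adjoint_image_adjoint Sh /adjoint_image_adjoint Sk;
    apply: adjointE => //; exact: adjoint_image_lin.
split=> [|a h k dh dk|a h k dh dk]; last 2 first.
- by case: (lin a h k dh dk).
- by case: (lin a h k dh dk).
by exists 0 => h Sh; rewrite !linear0r.
Qed.

Lemma inner_pair_continuousr (x y : H) :
  continuous (fun p : H * H => inner H x p.1 - inner H y p.2 : K^o).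
Proof.
move=> p; apply: cvgB.
  apply: (@cvg_comp _ _ _ fst (fun h => inner H x h : K^o));
  [exact: cvg_fst | exact: inner_continuousr].
apply: (@cvg_comp _ _ _ snd (fun h => inner H y h : K^o));
  [exact: cvg_snd | exact: inner_continuousr].
Qed.

Lemma inner_pair_continuousl (x y : H) :
  continuous (fun p : H * H => inner H p.2 y - inner H p.1 x : K^o).
Proof.
move=> p; apply: cvgB.
  apply: (@cvg_comp _ _ _ snd (fun h => inner H h y : K^o));
  [exact: cvg_snd | exact: inner_continuousl].
apply: (@cvg_comp _ _ _ fst (fun h => inner H h x : K^o));
  [exact: cvg_fst | exact: inner_continuousl].
Qed.

(** The relation that defines the adjoint consists, for each h in dom S, of one
    equation that is continuous in the pair; so it passes to limits. *)
Lemma adjoint_graph_closed S (A : set (H * H)) :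
  (forall p, A p -> adjoint_image S p.1 p.2) ->
  forall p, closure A p -> adjoint_image S p.1 p.2.
Proof.
move=> AS p clAp h Sh; apply/eqP; rewrite -subr_eq0; apply/eqP.
apply: (closure_continuous_eq0 (@inner_pair_continuousr (S h) h)) clAp.
by move=> q /AS/(_ h Sh) ->; rewrite subrr.
Qed.

(** The same equation is also continuous in the pair (h, S h), so that it
    extends from the graph of S to its closure. *)
Lemma adjoint_image_closure S T : op_graph T = closure (op_graph S) ->
  adjoint_image T = adjoint_image S.
Proof.
move=> GT; apply/funext => k; apply/seteqP; split=> h' adj h hD.
  have [/= Th ->] : op_graph T (h, S h) by rewrite GT; exact: subset_closure.
  exact: adj.
apply/eqP; rewrite -subr_eq0; apply/eqP.
have cl_h : closure (op_graph S) (h, T h) by rewrite -GT.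
have on_graph (p : H * H) :
    op_graph S p -> inner H p.2 k - inner H p.1 h' = 0.
  by move=> [Sp ->]; rewrite adj// subrr.
exact: (closure_continuous_eq0 (@inner_pair_continuousl h' k) on_graph cl_h).
Qed.

Lemma adjoint_closure S T : op_graph T = closure (op_graph S) ->
  adjoint T = adjoint S.
Proof. by move=> /adjoint_image_closure; rewrite /adjoint => ->. Qed.

Lemma op_graph_closure_op S T : op_graph T = closure (op_graph S) ->
  op_graph (closure_op S) = closure (op_graph S).
Proof.
move=> GT; have uniq h k : closure (op_graph S) (h, k) -> k = T h.
  by rewrite -GT => -[].
have val h : (exists k, closure (op_graph S) (h, k)) ->
    closure (op_graph S) (h, closure_op S h).
  by move=> [k cl_k]; exact: (@getI _ [set k | closure _ (h, k)] _ cl_k).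
apply/seteqP; split=> -[h k]; first by move=> [/= /val + ->].
move=> clhk; have dh : dom (closure_op S) h by exists k.
by split=> //=; rewrite (uniq _ _ clhk); apply/esym/uniq/val.
Qed.

Lemma op_graph_sub S T : op_graph S `<=` op_graph T ->
  forall h, dom S h -> dom T h /\ T h = S h.
Proof. by move=> ST h Sh; have [//|/= Th ->] := ST (h, S h). Qed.

End Adjoint.

(** * Essential selfadjointness *)

Section EssentialSelfadjointness.
Context {R : realType} {s : scalar_kind} {H : hilbertType R s}.
Local Notation K := (scalar_field R s).
Implicit Types S T : operator H.

Lemma op_graph_eqP S T : op_graph S = op_graph T <->
  dom S = dom T /\ (forall h, dom T h -> S h = T h).
Proof.
split=> [G|[domST eqST]].
  split=> [|h Th]; last first.
    by have [] := op_graph_sub (S := T) (T := S) _ Th; rewrite ?G.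
  apply/seteqP; split=> h.
    by move=> Sh; have [] := op_graph_sub (T := T) _ Sh; rewrite ?G.
  by move=> Th; have [] := op_graph_sub (T := S) _ Th; rewrite ?G.
by apply/seteqP; split=> -[h k] [/= dh ->]; split;
  rewrite /= ?eqST ?domST// -domST.
Qed.

Lemma selfadjoint_graphP T : selfadjoint T <->
  densely_defined T /\ op_graph (adjoint T) = op_graph T.
Proof.
split=> [[dT domT appT]|[dT /op_graph_eqP[domT appT]]]; last by split.
by split=> //; apply/op_graph_eqP.
Qed.

(** If the closure T of S is selfadjoint, then S^* = T^* = T.  Conversely, if
    S^* has the closure of the graph of S as its graph, it witnesses that S is
    closable, it is the closure of S, and its adjoint is again S^*. *)
Lemma essentially_selfadjointP S : essentially_selfadjoint S <->
  densely_defined S /\ op_graph (adjoint S) = closure (op_graph S).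
Proof.
split=> [[dS [T [_ GT]] /selfadjoint_graphP[_]]|[dS GA]].
  have Gcl := op_graph_closure_op GT.
  by rewrite (adjoint_closure Gcl) Gcl.
have Gcl := op_graph_closure_op GA.
split=> //.
  by exists (adjoint S); split=> //; exact: linear_operator_adjoint.
apply/selfadjoint_graphP; rewrite (adjoint_closure Gcl) Gcl; split=> //.
move=> O O0 oO; have [x [Ox Sx]] := dS O O0 oO; exists x; split=> //.
by exists (S x); exact: subset_closure.
Qed.

Lemma op_wedge_adjoint S : densely_defined S ->
  op_wedge S S <-> op_graph S `<=` op_graph (adjoint S).
Proof.
move=> dS; rewrite op_graph_adjoint//; split=> [wS [h k] [/= Sh ->] x Sx|sub].
  exact: wS.
by move=> h k Sh Sk; exact: (sub (k, S k)).
Qed.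

Lemma essentially_selfadjoint_point_spectrum S (lambda : K) :
  essentially_selfadjoint S -> lambda \is Num.real -> lambda != 0 ->
  ~ point_spectrum (op_comp (adjoint S) (adjoint S)) (- lambda ^+ 2).
Proof.
move=> /essentially_selfadjointP[dS GA] lreal l0 [h [h0 [dh dAh] AAh]].
have {}AAh : adjoint S (adjoint S h) = - lambda ^+ 2 *: h by [].
(* S^* is the closure of S, so the relation that defines S^* h may be tested
   against S^* h itself, although S^* h need not lie in dom S. *)
have := adjoint_image_adjoint dh; rewrite -(adjoint_image_closure GA).
move=> /(_ _ dAh); rewrite AAh linearZl_LR/= => E.
have : 0 <= - lambda ^+ 2 * inner H h h by rewrite E dot_ge0.
have l2 : 0 < lambda ^+ 2 by rewrite -real_normK// exprn_gt0// normr_gt0.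
by rewrite mulNr oppr_ge0 lt_geF// mulr_gt0// neq0_dnorm_gt0.
Qed.

(** The complement of the graph of S in the graph of S^*, for the inner product
    of weight c, consists of the pairs (h, S^* h) with S^* S^* h = - c h:
    orthogonality to (x, S x) reads <S x, S^* h> = <x, - c h>. *)
Lemma adjoint_sub_closure S (c : {posnum K}) : linear_operator S ->
  densely_defined S -> op_wedge S S ->
  ~ point_spectrum (op_comp (adjoint S) (adjoint S)) (- c%:num) ->
  op_graph (adjoint S) `<=` closure (op_graph S).
Proof.
move=> [S0 SD SL] dS /(op_wedge_adjoint dS) wS noeig [h k].
rewrite op_graph_adjoint// => /= adj_hk.
have GS0 : op_graph S 0.
  split=> //=; have := SL (-1) _ _ S0 S0.
  by rewrite scaler0 add0r scaleN1r addNr.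
have GSlin (a : K) p q :
    op_graph S p -> op_graph S q -> op_graph S (a *: p + q).
  by move=> [Sp Ep] [Sq Eq]; split=> /=; [exact: SD|rewrite SL// -Ep -Eq].
have [z clz z_ortho] := weighted_projection c GS0 GSlin (h, k).
have adj_z : adjoint_image S z.1 z.2.
  by apply: adjoint_graph_closed clz => p /wS; rewrite op_graph_adjoint.
pose w := (h, k) - z.
have adj_w : adjoint_image S w.1 w.2.
  have := adjoint_image_lin (-1) adj_z adj_hk.
  by rewrite !scaleN1r ![- _ + _]addrC.
(* The orthogonality of w to (x, S x), conjugated. *)
have adj_w2 : adjoint_image S w.2 (- c%:num *: w.1).
  move=> x Sx; have := z_ortho (x, S x) (conj Sx erefl).
  move=> /(congr1 (@scalar_conj R s)); rewrite rmorph0 rmorphD rmorphM.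
  rewrite -!dot_conj (scalar_conj_real (a := c%:num))// => /eqP.
  rewrite addrC addr_eq0 => /eqP ->.
  by rewrite linearZr_LR/= rmorphN scalar_conj_real// mulNr.
have [dw1 Aw1] := adjointE dS adj_w.
have [dw2 Aw2] := adjointE dS adj_w2.
rewrite -Aw1 in dw2 Aw2.
have w1_0 : w.1 = 0.
  apply: contrapT => /eqP w1_neq0; apply: noeig; exists w.1.
  by [].
have w2_0 : w.2 = 0.
  apply: (adjoint_image_unique dS adj_w); rewrite w1_0 => x Sx.
  by rewrite !linear0r.
have w0 : w = 0 by rewrite [w]surjective_pairing w1_0 w2_0.
by have /subr0_eq -> := w0.
Qed.

Lemma essentially_selfadjoint_of_point_spectrum S (lambda : K) :
  linear_operator S -> densely_defined S -> op_wedge S S ->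
  lambda \is Num.real -> lambda != 0 ->
  ~ point_spectrum (op_comp (adjoint S) (adjoint S)) (- lambda ^+ 2) ->
  essentially_selfadjoint S.
Proof.
move=> linS dS wS lreal l0 noeig; apply/essentially_selfadjointP; split=> //.
have l2 : 0 < lambda ^+ 2 by rewrite -real_normK// exprn_gt0// normr_gt0.
apply/seteqP; split; first exact: (@adjoint_sub_closure S (PosNum l2)).
rewrite op_graph_adjoint//; apply: adjoint_graph_closed => p.
by move=> /((op_wedge_adjoint dS).1 wS); rewrite op_graph_adjoint.
Qed.

Lemma essentially_selfadjoint_wedge S : essentially_selfadjoint S ->
  op_wedge S S.
Proof.
move=> /essentially_selfadjointP[dS GA]; apply/op_wedge_adjoint => //.
by rewrite GA; exact: subset_closure.
Qed.

End EssentialSelfadjointness.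

(* Num.real is the set of real elements of the scalar field. *)
Theorem corollary4p9 (R : realType) (s : scalar_kind) (H : hilbertType R s)
    (S : operator H) (hS : linear_operator S) :
  (essentially_selfadjoint S <->
     [/\ densely_defined S, op_wedge S S
       & exists lambda : scalar_field R s,
           [/\ lambda \is Num.real, lambda != 0
             & ~ point_spectrum (op_comp (adjoint S) (adjoint S))
                   (- lambda ^+ 2)]])
  /\
  (essentially_selfadjoint S <->
     [/\ densely_defined S, op_wedge S S
       & forall lambda : scalar_field R s,
           lambda \is Num.real -> lambda != 0 ->
           ~ point_spectrum (op_comp (adjoint S) (adjoint S))
               (- lambda ^+ 2)]).
Proof.
have esa_all (esaS : essentially_selfadjoint S) :
    [/\ densely_defined S, op_wedge S S
      & forall lambda : scalar_field R s, lambda \is Num.real -> lambda != 0 ->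
        ~ point_spectrum (op_comp (adjoint S) (adjoint S)) (- lambda ^+ 2)].
  split; [by case: esaS|exact: essentially_selfadjoint_wedge|].
  by move=> lambda; exact: essentially_selfadjoint_point_spectrum.
split; split=> [esaS|[dS wS]].
- have [dS wS all_lambda] := esa_all esaS; split=> //.
  by exists 1; split; [exact: real1|exact: oner_neq0|apply: all_lambda].
- by move=> [lambda [lreal l0]];
    exact: essentially_selfadjoint_of_point_spectrum lreal l0.
- exact: esa_all.
- move=> all_lambda.
  apply: (@essentially_selfadjoint_of_point_spectrum _ _ _ S 1) => //.
  exact: all_lambda.
Qed.
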